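(* Consider the semi-random corruption model with corruption probability $p$. Assume that $r_{\bar x},r_{\bar y},r_{\bar z}$ are positive constants (independent of $n,m,l$) with $r_{\bar x}\ge r_{\bar y}\ge r_{\bar z}$. Assume that, as $n,m,l\to\infty$, the six quantities $n\exp(-m)$, $n\exp(-l)$, $m\exp(-n)$, $m\exp(-l)$, $l\exp(-n)$, $l\exp(-m)$ all tend to $0$. If $p$ is a constant satisfying $$p<\frac{r_{\bar x}r_{\bar y}r_{\bar z}}{2(1+r_{\bar x}r_{\bar y}r_{\bar z})+\delta},$$ where $$\delta:=\tfrac12 r_{\bar x}r_{\bar y}+\tfrac12 r_{\bar x}r_{\bar z}-r_{\bar y}r_{\bar z}+r_{\bar x}-\tfrac12 r_{\bar y}-\tfrac12 r_{\bar z}\ \ge 0,$$ then the standard LP (sLP) recovers the ground truth with high probability.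
   Context: Write $[n]=\{1,\dots,n\}$. For vectors $x\in\mathbb R^n,y\in\mathbb R^m,z\in\mathbb R^l$, $x\otimes y\otimes z$ is the $n\times m\times l$ tensor with $(i,j,k)$ entry $x_iy_jz_k$. Fully-random corruption model: fix $\bar x\in\{0,1\}^n$, $\bar y\in\{0,1\}^m$, $\bar z\in\{0,1\}^l$; the ground truth is $\bar{\mathcal W}=\bar x\otimes\bar y\otimes\bar z$. Given $p\in[0,1]$, the random noisy binary tensor $\mathcal G=(g_{ijk})$ is obtained by corrupting each entry independently: $g_{ijk}=1-\bar x_i\bar y_j\bar z_k$ with probability $p$ and $g_{ijk}=\bar x_i\bar y_j\bar z_k$ with probability $1-p$. Semi-random corruption model: first $\mathcal G$ is generated by the fully-random model; then an adversary modifies $\mathcal G$ by an arbitrary sequence of monotone transformations, i.e. the adversary may choose any set of corrupted entries (entries where $\mathcal G$ differs from $\bar{\mathcal W}$) and revert them to their values in $\bar{\mathcal W}$. The resulting tensor is the input of the optimization problem. $r_{\bar x}$ (resp. $r_{\bar y}$, $r_{\bar z}$) is the ratio of the number of ones in $\bar x$ (resp. $\bar y$, $\bar z$) to its number of entries. Given an input binary tensor $\mathcal G=(g_{ijk})$, let $S_0=\{(i,j,k)\in[n]\times[m]\times[l]:g_{ijk}=0\}$ and $S_1=\{(i,j,k)\in[n]\times[m]\times[l]:g_{ijk}=1\}$. The standard LP (sLP), in variables $x\in\mathbb R^n,y\in\mathbb R^m,z\in\mathbb R^l,\mathcal W=(w_{ijk})\in\mathbb R^{n\times m\times l}$, is $$\begin{aligned}\min\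 &\sum_{(i,j,k)\in S_0}w_{ijk}+\sum_{(i,j,k)\in S_1}(1-w_{ijk})\\ \text{s.t. }& w_{ijk}\le x_i,\ w_{ijk}\le y_j,\ w_{ijk}\le z_k,\quad\forall(i,j,k)\in S_1,\\ & w_{ijk}\ge0,\ w_{ijk}\ge x_i+y_j+z_k-2,\quad\forall(i,j,k)\in S_0,\\ &(x,y,z)\in[0,1]^{n+m+l}.\end{aligned}$$ It recovers the ground truth if it has a unique optimal solution and this solution is $(\bar x,\bar y,\bar z,\bar{\mathcal W})$. ''With high probability'' means with probability tending to $1$ as $n,m,l\to\infty$ (along a family of instances whose three dimensions all go to infinity). *)

(* Defs.v *)
(* MathComp / MathComp-Analysis *)
From HB Require Import structures.
From mathcomp Require Import all_boot all_order all_algebra.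
From mathcomp Require Import all_classical all_reals all_analysis.

Set Implicit Arguments.
Unset Strict Implicit.
Unset Printing Implicit Defensive.

Import Order.TTheory GRing.Theory Num.Theory.
Import numFieldNormedType.Exports.

Local Open Scope ring_scope.

Notation tensor T n m l := {ffun 'I_n * 'I_m * 'I_l -> T}.

(* Binary vectors and tensors have entries in bool; they enter the linear
   program through this 0/1 embedding. *)
Definition embed01 (R : realType) (I : finType) (f : {ffun I -> bool}) :
  {ffun I -> R} := [ffun i => (f i)%:R].

(* The rank-one tensor x (x) y (x) z of binary vectors. *)
Definition outer (n m l : nat) (x : {ffun 'I_n -> bool})
    (y : {ffun 'I_m -> bool}) (z : {ffun 'I_l -> bool}) : tensor bool n m l :=
  [ffun e => let: (i, j, k) := e in [&& x i, y j & z k]].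

Definition ratio_ones (R : realType) (n : nat) (x : {ffun 'I_n -> bool}) : R :=
  #|[set i | x i]|%:R / n%:R.

Definition corrupted (n m l : nat) (W G : tensor bool n m l) :
  {set 'I_n * 'I_m * 'I_l} := [set e | G e != W e].

(* Law of the fully-random model with ground truth W: the entries are flipped
   independently with probability p, so each point mass is a product. *)
Definition fully_random (R : realType) (n m l : nat) (p : R)
    (W G : tensor bool n m l) : R :=
  \prod_e (if e \in corrupted W G then p else 1 - p).

Definition fully_random_pr (R : realType) (n m l : nat) (p : R)
    (W : tensor bool n m l) (E : tensor bool n m l -> Prop) : R :=
  \sum_(G : tensor bool n m l | `[< E G >]) fully_random p W G.

(* A composition of monotone transformations is again the reversion of a single
   set of corrupted entries. *)
Definition monotone_transform (n m l : nat) (W G H : tensor bool n m l) : Prop :=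
  exists2 S : {set 'I_n * 'I_m * 'I_l},
    S \subset corrupted W G & H = [ffun e => if e \in S then W e else G e].

(* The adversary observes the whole realization of the noisy tensor. *)
Definition monotone_adversary (n m l : nat) (W : tensor bool n m l)
    (adv : tensor bool n m l -> tensor bool n m l) : Prop :=
  forall G, monotone_transform W G (adv G).

Definition S0 (n m l : nat) (G : tensor bool n m l) :
  {set 'I_n * 'I_m * 'I_l} := [set e | ~~ G e].

Definition S1 (n m l : nat) (G : tensor bool n m l) :
  {set 'I_n * 'I_m * 'I_l} := [set e | G e].

Record lp_point (R : realType) (n m l : nat) := LPPoint {
  lp_x : {ffun 'I_n -> R};
  lp_y : {ffun 'I_m -> R};
  lp_z : {ffun 'I_l -> R};
  lp_w : tensor R n m l
}.

Definition sLP_feasible (R : realType) (n m l : nat) (G : tensor bool n m l)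
    (s : lp_point R n m l) : Prop :=
  [/\ forall i j k, (i, j, k) \in S1 G ->
        [/\ lp_w s (i, j, k) <= lp_x s i,
            lp_w s (i, j, k) <= lp_y s j
          & lp_w s (i, j, k) <= lp_z s k],
      forall i j k, (i, j, k) \in S0 G ->
        0 <= lp_w s (i, j, k) /\
        lp_x s i + lp_y s j + lp_z s k - 2 <= lp_w s (i, j, k),
      forall i, 0 <= lp_x s i <= 1,
      forall j, 0 <= lp_y s j <= 1
    & forall k, 0 <= lp_z s k <= 1].

Definition sLP_objective (R : realType) (n m l : nat) (G : tensor bool n m l)
    (s : lp_point R n m l) : R :=
  \sum_(e in S0 G) lp_w s e + \sum_(e in S1 G) (1 - lp_w s e).

Definition sLP_optimal (R : realType) (n m l : nat) (G : tensor bool n m l)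
    (s : lp_point R n m l) : Prop :=
  sLP_feasible G s /\
  forall t, sLP_feasible G t -> sLP_objective G s <= sLP_objective G t.

Definition sLP_recovers (R : realType) (n m l : nat)
    (x : {ffun 'I_n -> bool}) (y : {ffun 'I_m -> bool})
    (z : {ffun 'I_l -> bool}) (G : tensor bool n m l) : Prop :=
  forall s : lp_point R n m l, sLP_optimal G s <->
    s = LPPoint (embed01 R x) (embed01 R y) (embed01 R z)
                (embed01 R (outer x y z)).

Definition delta (R : realType) (rx ry rz : R) : R :=
  1 / 2 * rx * ry + 1 / 2 * rx * rz - ry * rz + rx - 1 / 2 * ry - 1 / 2 * rz.

(* Main.v *)
Require Import Defs.
From HB Require Import structures.
From mathcomp Require Import all_boot all_order all_algebra.
From mathcomp Require Import all_classical all_reals all_analysis.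
From mathcomp Require Import ring lra.

Set Implicit Arguments.
Unset Strict Implicit.
Unset Printing Implicit Defensive.
Import Order.TTheory GRing.Theory Num.Theory.
Import numFieldNormedType.Exports.

Local Open Scope classical_set_scope.
Local Open Scope ring_scope.

(** Let a, b, c be the distances of a feasible (x, y, z) from the ground truth,
    coordinate by coordinate ([gap]).  Each entry e = (i, j, k) of the tensor
    changes the objective, relative to the ground truth, by at least a linear
    form A_e a_i + B_e b_j + C_e c_k whose coefficients ([slope_x], [slope_y],
    [slope_z]) depend only on the three ground-truth bits at e and on whether
    e is corrupted ([entry_gain]).  Such forms come from linearizing the optimal
    choice of w_e in four ways:
    - an intact entry of the all-ones block costs max(a_i, b_j, c_k), which is
      at least any convex combination of the three;
    - a corrupted entry of that block gains at most a_i + b_j + c_k;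
    - an intact entry with exactly one zero bit, say the third, costs
      max(0, c_k - a_i - b_j), which is at least lambda (c_k - a_i - b_j) for
      every lambda in [0, 1];
    - a corrupted entry outside the block gains min(x_i, y_j, z_k), which is at
      most the gap of whichever zero-bit coordinate one chooses.
    Reverting a corruption only raises the cost of an entry, so the form
    computed from the fully random tensor still bounds the cost after the
    adversary has acted.

    Summing over e, the total change is at least a combination of the a_i, b_j,
    c_k whose coefficients are sums of slopes over the slices of the tensor.  If
    all slice sums are positive then the ground truth is optimal, and an optimal
    point must have a = b = c = 0, hence also the right w: this is
    [recovers_of_drift_gt0].

    For a slice with M entries the sum consists of M independent terms in
    [-1, 1].  Put r = rx ry rz.  As delta is nonnegative, the hypothesis gives
    p < r / (2 (1 + r)), and then the weights can be chosen so that every slice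
    sum has mean at least eps M ([weights_exist]).  By a Chernoff bound
    ([corruption_chernoff]) it fails to be positive with probability at most
    exp (- eps^2 M / 8), and the union bound over the slices leaves terms such
    as n exp (- eps^2 m l / 8), which is eventually below n exp (- m) because l
    tends to infinity. *)

(** * The linear lower bound and its coefficients *)

(** The mean of f at a Bernoulli variable of parameter r.  It serves for the
    random corruptions, with r = p, and for averages along a binary vector, with
    r its ratio of ones. *)
Definition bmean {R : realType} (r : R) (f : bool -> R) : R :=
  r * f true + (1 - r) * f false.

(** [wt_x], [wt_y], [wt_z] weigh a_i, b_j, c_k in the lower bound for
    max(a_i, b_j, c_k) on the all-ones block; [cut_x] is the multiplier lambda on
    the entries whose only zero bit is the first, and similarly for [cut_y] and
    [cut_z]. *)
Record weights (R : realType) := Weights {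
  wt_x : R; wt_y : R; wt_z : R;
  cut_x : R; cut_y : R; cut_z : R
}.

(** A corrupted entry outside the block charges its gain to one of its zero-bit
    coordinates: to the first if that bit is zero, else to the second if that
    one is, else to the third.  With this priority the gains charged to the
    coordinates telescope: with q = p / (1 - p), multipliers slightly above
    q / (ry rz), q / rz and q compensate them on the slices at zero bits. *)
Definition slope_x {R : realType} (c : weights R) (u v w cor : bool) : R :=
  if cor then (if u then - (v && w)%:R else -1)
  else match u, v, w with
       | true, true, true => wt_x c
       | true, true, false => - cut_z c
       | true, false, true => - cut_y c
       | false, true, true => cut_x c
       | _, _, _ => 0
       end.

Definition slope_y {R : realType} (c : weights R) (u v w cor : bool) : R :=
  if cor then (if v then - (u && w)%:R else - u%:R)
  else match u, v, w with
       | true, true, true => wt_y c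
       | true, true, false => - cut_z c
       | true, false, true => cut_y c
       | false, true, true => - cut_x c
       | _, _, _ => 0
       end.

Definition slope_z {R : realType} (c : weights R) (u v w cor : bool) : R :=
  if cor then - (u && v)%:R
  else match u, v, w with
       | true, true, true => wt_z c
       | true, true, false => cut_z c
       | true, false, true => - cut_y c
       | false, true, true => - cut_x c
       | _, _, _ => 0
       end.

(** Besides making the linear bounds valid, these conditions keep all slopes in
    [-1, 1]. *)
Definition admissible {R : realType} (c : weights R) : Prop :=
  [/\ [/\ 0 <= wt_x c, 0 <= wt_y c & 0 <= wt_z c],
      wt_x c + wt_y c + wt_z c <= 1,
      0 <= cut_x c <= 1, 0 <= cut_y c <= 1 & 0 <= cut_z c <= 1].

(** The bounded quantities are the means, per entry, of the slice sums: along a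
    slice one bit is fixed and the two others run through their vectors. *)
Definition positive_drift {R : realType} (p rx ry rz eps : R) (c : weights R) : Prop :=
  [/\ forall u, eps <= bmean ry (fun v => bmean rz (fun w => bmean p (slope_x c u v w))),
      forall v, eps <= bmean rx (fun u => bmean rz (fun w => bmean p (slope_y c u v w)))
    & forall w, eps <= bmean rx (fun u => bmean ry (fun v => bmean p (slope_z c u v w)))].

(** Choose the multipliers so that the slices at zero bits have a small surplus
    s, and then wt_x, wt_y, wt_z so that the slices at one bits have it too.  The
    remaining constraint wt_x + wt_y + wt_z <= 1 reads, after multiplication by
    1 - p and with a, b, d the inverses of rx, ry, rz,
      3 (p + s) + 2 p (a b d - 1) + 2 s (a + b + d - 3) <= 1 - p.
    At s = 0 it is strict exactly when p < r / (2 (1 + r)), where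
    r = rx ry rz. *)
Lemma weights_exist (R : realType) (p rx ry rz : R) :
  0 < rx <= 1 -> 0 < ry <= 1 -> 0 < rz <= 1 -> 0 <= p ->
  p < rx * ry * rz / (2 * (1 + rx * ry * rz)) ->
  exists c : weights R, exists2 eps,
    0 < eps <= 1 & admissible c /\ positive_drift p rx ry rz eps c.
Proof.
move=> /andP[rx0 rx1] /andP[ry0 ry1] /andP[rz0 rz1] p0 hp.
have r0 : 0 < rx * ry * rz by rewrite !mulr_gt0.
move: hp; rewrite ltr_pdivlMr; last by lra.
move=> hp.
have [[a Da] [b Db] [d Dd]] : [/\ exists a, a = rx^-1, exists b, b = ry^-1
    & exists d, d = rz^-1] by split; eexists.
have Ea : rx * a = 1 by rewrite Da mulfV ?gt_eqF.
have Eb : ry * b = 1 by rewrite Db mulfV ?gt_eqF.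
have Ed : rz * d = 1 by rewrite Dd mulfV ?gt_eqF.
have a1 : 1 <= a by rewrite Da invf_ge1.
have b1 : 1 <= b by rewrite Db invf_ge1.
have d1 : 1 <= d by rewrite Dd invf_ge1.
have abd : 1 <= a * b * d by rewrite !mulr_ege1.
have bd1 : 1 <= b * d by rewrite !mulr_ege1.
have Er : rx * ry * rz * (a * b * d) = 1.
  have -> : rx * ry * rz * (a * b * d) = rx * a * (ry * b) * (rz * d) by ring.
  by rewrite Ea Eb Ed !mulr1.
have k0 : 0 < 1 - 2 * p - 2 * p * (a * b * d).
  have : p * (2 * (1 + rx * ry * rz)) * (a * b * d) < rx * ry * rz * (a * b * d).
    by rewrite ltr_pM2r //; lra.
  have -> : p * (2 * (1 + rx * ry * rz)) * (a * b * d)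
    = 2 * p * (a * b * d) + 2 * p * (rx * ry * rz * (a * b * d)) by ring.
  by rewrite Er; lra.
(* The value of s for which the weights sum to exactly 1. *)
pose D := 3 + 2 * (a - 1 + (b - 1) + (d - 1)).
have D0 : 3 <= D by rewrite /D; lra.
pose s : R := (1 - 2 * p - 2 * p * (a * b * d)) / D.
have s0 : 0 < s by rewrite divr_gt0 //; lra.
have sD : s * D = 1 - 2 * p - 2 * p * (a * b * d) by rewrite mulfVK // gt_eqF //; lra.
clearbody s.
have h : 0 <= p * (a * b * d) by rewrite mulr_ge0 //; lra.
have p1 : 0 < 1 - p by nra.
have q0 : 1 - p != 0 by rewrite gt_eqF.
pose lx := p * (b * d) + s; pose ly := p * d + s; pose lz := p + s.
have pd : p <= p * d by rewrite ler_peMr.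
have pbd : p * d <= p * (b * d) by rewrite ler_wpM2l // ler_peMl //; lra.
have pabd : p * (b * d) <= p * (a * b * d).
  by rewrite ler_wpM2l // -mulrA ler_peMl //; lra.
have s3 : s * 3 <= s * D by rewrite ler_wpM2l // ltW.
have lx1 : lx <= 1 - p by rewrite /lx; lra.
have ul : 0 <= (a - 1) * lx by rewrite mulr_ge0 /lx; lra.
have vl : 0 <= (b - 1) * ly by rewrite mulr_ge0 /ly; lra.
have wl : 0 <= (d - 1) * lz by rewrite mulr_ge0 /lz; lra.
(* wt_x, wt_y and wt_z, multiplied by 1 - p like the multipliers above. *)
pose al := p + s + (b - 1) * ly + (d - 1) * lz.
pose be := p + s + (a - 1) * lx + (d - 1) * lz.
pose ga := p + s + (a - 1) * lx + (b - 1) * ly.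
exists (Weights (al / (1 - p)) (be / (1 - p)) (ga / (1 - p))
  (lx / (1 - p)) (ly / (1 - p)) (lz / (1 - p))); exists (rx * ry * rz * s).
  rewrite mulr_gt0 //=; apply: (@le_trans _ _ (1 * s)); last by lra.
  by rewrite ler_pM2r // !mulr_ile1 ?mulr_ge0 //; exact: ltW.
have in01 t : 0 <= t <= 1 - p -> 0 <= t / (1 - p) <= 1.
  by move=> /andP[t0 t1]; rewrite divr_ge0 ?ler_pdivrMr ?mul1r //; lra.
have KC t : (1 - p) * (t / (1 - p)) = t by field.
have KN t : (1 - p) * (- (t / (1 - p))) = - t by field.
split.
  split => /=.
  - by split; apply: divr_ge0; rewrite ?/al ?/be ?/ga; lra.
  - rewrite -!mulrDl ler_pdivrMr // mul1r.
    have -> : al + be + ga = 1 - p - (1 - 2 * p - 2 * p * (a * b * d)) + s * D.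
      by rewrite /al /be /ga /lx /ly /lz /D; ring.
    by rewrite sD; lra.
  - by apply: in01; rewrite /lx in lx1 *; lra.
  - by apply: in01; rewrite /lx /ly in lx1 *; lra.
  - by apply: in01; rewrite /lx /lz in lx1 *; lra.
have [x0 y0 z0 s0'] : [/\ 0 <= rx, 0 <= ry, 0 <= rz & 0 <= s] by split; exact: ltW.
have ex : rx * ry * rz * s <= ry * rz * s.
  by rewrite -!mulrA ler_piMl // !mulr_ge0.
have ey : rx * ry * rz * s <= rx * rz * s.
  have -> : rx * ry * rz * s = ry * (rx * rz * s) by ring.
  by rewrite ler_piMl // !mulr_ge0.
have ez : rx * ry * rz * s <= rx * ry * s.
  have -> : rx * ry * rz * s = rz * (rx * ry * s) by ring.
  by rewrite ler_piMl // !mulr_ge0.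
split.
- move=> u; apply: le_trans ex _; rewrite [leRHS](_ : _ = ry * rz * s) //.
  case: u; rewrite /bmean /slope_x /= ?KC ?KN.
    by rewrite /al /ly /lz Db Dd; field; rewrite !gt_eqF.
  by rewrite /lx Db Dd; field; rewrite !gt_eqF.
- move=> v; apply: le_trans ey _; rewrite [leRHS](_ : _ = rx * rz * s) //.
  case: v; rewrite /bmean /slope_y /= ?KC ?KN.
    by rewrite /be /lx /lz Da Db Dd; field; rewrite !gt_eqF.
  by rewrite /ly Dd; field; rewrite !gt_eqF.
- move=> w; apply: le_trans ez _; rewrite [leRHS](_ : _ = rx * ry * s) //.
  case: w; rewrite /bmean /slope_z /= ?KC ?KN.
    by rewrite /ga /lx /ly Da Db Dd; field; rewrite !gt_eqF.
  by rewrite /lz; ring.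
Qed.

Definition gap {R : realType} (u : bool) (t : R) : R := if u then 1 - t else t.

(** The hypothesis on h allows the adversary to restore the entry: the slopes
    are those of the random value g, while feasibility and cost are those of h.
    The cost at the ground truth is 1 when h is corrupted and 0 otherwise. *)
Lemma entry_gain (R : realType) (c : weights R) (x y z t : R) (u v w g h : bool) :
  admissible c -> 0 <= x <= 1 -> 0 <= y <= 1 -> 0 <= z <= 1 ->
  h = g \/ h = [&& u, v & w] ->
  (h -> [/\ t <= x, t <= y & t <= z]) ->
  (~~ h -> 0 <= t /\ x + y + z - 2 <= t) ->
  let d := g != [&& u, v & w] in
  slope_x c u v w d * gap u x + slope_y c u v w d * gap v y
    + slope_z c u v w d * gap w z
  <= (if h then 1 - t else t) - (h != [&& u, v & w])%:R.
Proof.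
case: c => a b c lx ly lz; case=> /= -[a0 b0 c0] abc lx01 ly01 lz01 x01 y01 z01.
(* A multiple l * s is at most max (0, s). *)
have cut (l s r : R) : 0 <= l <= 1 -> 0 <= r -> s <= r -> l * s <= r.
  move=> /andP[l0 l1] r0 sr; have [s0|s0] := leP s 0.
    by apply: le_trans r0; rewrite mulr_ge0_le0.
  by apply: le_trans sr; rewrite ler_piMl // ltW.
move=> hg h1 h0.
case: h h1 h0 hg => [/(_ isT)[tx ty tz] _|_ /(_ isT)[t0 tt]] hg;
  case: g hg => hg; case: u hg; case: v; case: w => -[//|] //= _;
  rewrite /slope_x /slope_y /slope_z /gap /=; try lra.
all: try (have := cut lx (y + z - x - 1) t lx01 t0; nra).
all: try (have := cut ly (x + z - y - 1) t ly01 t0; nra).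
all: try (have := cut lz (x + y - z - 1) t lz01 t0; nra).
all: nra.
Qed.

(** * Concentration of the slice sums *)

(** From exp (- s) >= 1 - s one gets exp s <= 1 / (1 - s), and
    (1 - s) (1 + s + 2 s^2) = 1 + s^2 (1 - 2 s) >= 1. *)
Lemma expR_le_quadratic (R : realType) (s : R) :
  s <= 1 / 2 -> expR s <= 1 + s + 2 * s ^+ 2.
Proof.
move=> s2; rewrite -[s in expR s]opprK expRN invf_ple ?posrE ?expR_gt0 //; last by nra.
apply: le_trans (expR_ge1Dx (- s)).
have q0 : 0 < 1 + s + 2 * s ^+ 2 by nra.
rewrite -[_^-1]mul1r ler_pdivrMr //.
have : 0 <= s ^+ 2 * (1 - 2 * s) by rewrite mulr_ge0 ?sqr_ge0 //; lra.
by lra.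
Qed.

Lemma fully_random_ge0 (R : realType) (n m l : nat) (p : R) (W G : tensor bool n m l) :
  0 <= p <= 1 -> 0 <= fully_random p W G.
Proof. by move=> p01; apply: prodr_ge0 => e _; case: ifP => _; lra. Qed.

(** Independence of the corruptions: the expectation of a product of functions of
    the individual entries is the product of the expectations. *)
Lemma fully_random_expectation (R : realType) (n m l : nat) (p : R)
    (W : tensor bool n m l) (phi : 'I_n * 'I_m * 'I_l -> bool -> R) :
  \sum_G fully_random p W G * \prod_e phi e (G e != W e)
  = \prod_e bmean p (phi e).
Proof.
pose F e b := (if b != W e then p else 1 - p) * phi e (b != W e).
rewrite (eq_bigr (fun G : tensor bool n m l => \prod_e F e (G e))); last first.
  by move=> G _; rewrite -big_split; apply: eq_bigr => e _; rewrite /F inE.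
rewrite -(bigA_distr_bigA F); apply: eq_bigr => e _.
rewrite big_bool /F /bmean /=.
by case: (W e) => //=; rewrite addrC.
Qed.

Lemma union_bound (R : realType) (n m l : nat) (p : R) (W : tensor bool n m l)
    (J : finType) (B : J -> tensor bool n m l -> Prop) (E : tensor bool n m l -> Prop) :
  0 <= p <= 1 -> (forall G, (forall j, ~ B j G) -> E G) ->
  1 - \sum_j fully_random_pr p W (B j) <= fully_random_pr p W E <= 1.
Proof.
move=> p01 BE.
have tot : \sum_G fully_random p W G = 1.
  have := fully_random_expectation p W (fun _ _ => 1).
  rewrite [in RHS]big1; last by move=> e _; rewrite /bmean; ring.
  by move=> <-; apply: eq_bigr => G _; rewrite big1 // mulr1.
have ge0 := fully_random_ge0 W _ p01.
rewrite /fully_random_pr; move: tot.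
rewrite (bigID (fun G => `[< E G >])) /=; set PE := BIG_F.
set S := \sum_(_ | `[< E _ >]) _; set S' := \sum_(_ | _) _ => tot.
have S'0 : 0 <= S' by apply: sumr_ge0.
suff : S' <= \sum_j \sum_(G | `[< B j G >]) fully_random p W G by lra.
rewrite (exchange_big_dep xpredT) //=.
rewrite [leRHS](bigID (fun G => `[< E G >])) /= addrC.
rewrite ler_wpDr //; first by apply: sumr_ge0 => G _; apply: sumr_ge0.
apply: ler_sum => G /asboolPn nE.
have [j Bj] : exists j, B j G.
  by apply: contrapT => nB; apply: nE; apply: BE => j Bj; apply: nB; exists j.
by rewrite (bigD1 j) ?asboolT //= lerDl sumr_ge0.
Qed.

(** Markov's inequality for exp (- t S), where S is the sum in question, at
    t = eps / 4: each factor has mean at most exp (- t mu + 2 t^2), with mu the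
    mean of its term, so that the exponents add up to at most
    - t eps M + 2 t^2 M = - eps^2 M / 8. *)
Lemma corruption_chernoff (R : realType) (n m l : nat) (p eps : R) (W : tensor bool n m l)
    (A : pred ('I_n * 'I_m * 'I_l)) (xi : 'I_n * 'I_m * 'I_l -> bool -> R) (M : R) :
  0 <= p <= 1 -> 0 < eps <= 1 -> (forall e d, `|xi e d| <= 1) ->
  \sum_(e | A e) 1 = M -> eps * M <= \sum_(e | A e) bmean p (xi e) ->
  fully_random_pr p W (fun G => \sum_(e | A e) xi e (G e != W e) <= 0)
  <= expR (- (eps ^+ 2 / 8 * M)).
Proof.
move=> p01 eps01 xi1 <- drift.
pose t := eps / 4.
pose phi e d := if A e then expR (- (t * xi e d)) else 1.
have ge0 := fully_random_ge0 W _ p01.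
have -> : expR (- (eps ^+ 2 / 8 * \sum_(e | A e) 1))
    = expR (- (eps * t * \sum_(e | A e) 1) + 2 * t ^+ 2 * \sum_(e | A e) 1).
  by congr expR; rewrite /t; field.
apply: (@le_trans _ _ (\prod_e bmean p (phi e))).
  rewrite -(fully_random_expectation p W) /fully_random_pr big_mkcond.
  apply: ler_sum => G _.
  have -> : \prod_e phi e (G e != W e)
      = expR (- (t * \sum_(e | A e) xi e (G e != W e))).
    by rewrite mulr_sumr -sumrN expR_sum [RHS]big_mkcond.
  case: asboolP => [S0|_]; last by rewrite mulr_ge0 // expR_ge0.
  rewrite ler_peMr // -expR0 ler_expR oppr_ge0 mulr_ge0_le0 // /t; lra.
apply: (@le_trans _ _ (\prod_(e | A e) expR (- (t * bmean p (xi e)) + 2 * t ^+ 2))).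
  rewrite [leRHS]big_mkcond; apply: ler_prod => e _; rewrite /phi.
  case: (A e); last by rewrite /bmean; lra.
  rewrite {1}/bmean addr_ge0 ?mulr_ge0 ?expR_ge0 //=; try lra.
  apply: le_trans (expR_ge1Dx _).
  have q d : expR (- (t * xi e d)) <= 1 - t * xi e d + 2 * t ^+ 2.
    have /ler_normlP[x1 x2] := xi1 e d.
    have x3 : xi e d ^+ 2 <= 1 by nra.
    have t0 : 0 <= t by rewrite /t; lra.
    apply: le_trans (expR_le_quadratic _) _; first by rewrite /t; nra.
    by rewrite sqrrN exprMn lerD2l // ler_pM2l // ler_piMr // sqr_ge0.
  have q1 := ler_wpM2l _ (q true); have q0 := ler_wpM2l _ (q false).
  apply: le_trans (lerD (q1 p _) (q0 (1 - p) _)) _; try lra.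
  by rewrite /bmean; lra.
rewrite -expR_sum ler_expR big_split /= sumrN -mulr_sumr.
rewrite lerD //; last by rewrite mulr_sumr mulr1.
by rewrite lerN2 [eps * t]mulrC -mulrA ler_wpM2l // /t; lra.
Qed.

Lemma slope_norm_le1 (R : realType) (c : weights R) (u v w d : bool) :
  admissible c ->
  [/\ `|slope_x c u v w d| <= 1, `|slope_y c u v w d| <= 1
    & `|slope_z c u v w d| <= 1].
Proof.
case: c => a b e lx ly lz [] /= [a0 b0 e0] abe lx01 ly01 lz01.
rewrite /slope_x /slope_y /slope_z /=.
by split; case: d; case: u; case: v; case: w => /=; rewrite ler_norml; lra.
Qed.

(** * Sums over slices *)

Lemma sum_triple (R : realType) (n m l : nat) (f : 'I_n * 'I_m * 'I_l -> R) :
  \sum_e f e = \sum_i \sum_j \sum_k f (i, j, k).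
Proof. by rewrite pair_bigA pair_bigA /=; apply: eq_bigr => -[[i j] k]. Qed.

Lemma sum_slice_x (R : realType) (n m l : nat) (f : 'I_n * 'I_m * 'I_l -> R) i0 :
  \sum_(e | e.1.1 == i0) f e = \sum_j \sum_k f (i0, j, k).
Proof.
rewrite big_mkcond sum_triple (bigD1 i0) //= [X in _ + X]big1 ?addr0; last first.
  by move=> i /negbTE ne; apply: big1 => j _; apply: big1 => k _; rewrite ne.
by apply: eq_bigr => j _; apply: eq_bigr => k _; rewrite eqxx.
Qed.

Lemma sum_slice_y (R : realType) (n m l : nat) (f : 'I_n * 'I_m * 'I_l -> R) j0 :
  \sum_(e | e.1.2 == j0) f e = \sum_i \sum_k f (i, j0, k).
Proof.
rewrite big_mkcond sum_triple; apply: eq_bigr => i _.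
rewrite (bigD1 j0) //= [X in _ + X]big1 ?addr0; last first.
  by move=> j /negbTE ne; apply: big1 => k _; rewrite ne.
by apply: eq_bigr => k _; rewrite eqxx.
Qed.

Lemma sum_slice_z (R : realType) (n m l : nat) (f : 'I_n * 'I_m * 'I_l -> R) k0 :
  \sum_(e | e.2 == k0) f e = \sum_i \sum_j f (i, j, k0).
Proof.
rewrite big_mkcond sum_triple; apply: eq_bigr => i _; apply: eq_bigr => j _.
rewrite (bigD1 k0) //= eqxx big1 ?addr0 // => k /negbTE ne.
by rewrite ne.
Qed.

(** Also true when n = 0, where the ratio of ones is the junk value 0 / 0 = 0. *)
Lemma sum_bvec (R : realType) (n : nat) (x : {ffun 'I_n -> bool}) (f : bool -> R) :
  \sum_i f (x i) = n%:R * bmean (ratio_ones R x) f.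
Proof.
case: n x => [|n] x; first by rewrite big_ord0 mul0r.
rewrite /bmean /ratio_ones; set k := #|_|.
have -> : \sum_i f (x i) = k%:R * f true + (n.+1%:R - k%:R) * f false.
  rewrite (bigID (fun i => x i)) /=; congr (_ + _).
    rewrite (eq_bigr (fun=> f true)); last by move=> i ->.
    by rewrite mulr_natl -sumr_const; apply: eq_bigl => i; rewrite inE.
  rewrite (eq_bigr (fun=> f false)); last by move=> i /negbTE ->.
  have -> : n.+1%:R - k%:R = #|~: [set i | x i]|%:R :> R.
    have := cardsC [set i | x i]; rewrite card_ord => /(congr1 (fun a => a%:R : R)).
    by rewrite natrD -/k => h; apply/eqP; rewrite subr_eq addrC h.
  by rewrite mulr_natl -sumr_const; apply: eq_bigl => i; rewrite !inE.
by field.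
Qed.

Lemma sum_bvec2 (R : realType) (m l : nat) (y : {ffun 'I_m -> bool})
    (z : {ffun 'I_l -> bool}) (f : bool -> bool -> R) :
  \sum_j \sum_k f (y j) (z k)
  = m%:R * l%:R * bmean (ratio_ones R y) (fun v => bmean (ratio_ones R z) (f v)).
Proof.
under eq_bigr => j _ do rewrite sum_bvec.
rewrite (sum_bvec y (fun v => l%:R * bmean (ratio_ones R z) (f v))).
by rewrite {1 3}/bmean; ring.
Qed.

(** * Recovery from positive slice sums *)

Lemma sLP_objectiveE (R : realType) (n m l : nat) (H : tensor bool n m l)
    (s : lp_point R n m l) :
  sLP_objective H s = \sum_e if H e then 1 - lp_w s e else lp_w s e.
Proof.
rewrite (bigID (fun e => H e)) /= addrC /sLP_objective; congr (_ + _).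
  by apply: eq_big => [e|e]; rewrite inE // => /negbTE ->.
by apply: eq_big => [e|e]; rewrite inE // => ->.
Qed.

Definition truth (R : realType) (n m l : nat) (x : {ffun 'I_n -> bool})
    (y : {ffun 'I_m -> bool}) (z : {ffun 'I_l -> bool}) : lp_point R n m l :=
  LPPoint (embed01 R x) (embed01 R y) (embed01 R z) (embed01 R (outer x y z)).

Lemma truth_feasible (R : realType) (n m l : nat) (x : {ffun 'I_n -> bool})
    (y : {ffun 'I_m -> bool}) (z : {ffun 'I_l -> bool}) (H : tensor bool n m l) :
  sLP_feasible H (truth R x y z).
Proof.
split; rewrite /truth /=.
- move=> i j k _; rewrite !ffunE.
  by case: (x i); case: (y j); case: (z k) => /=; split; lra.
- move=> i j k _; rewrite !ffunE.
  by case: (x i); case: (y j); case: (z k) => /=; split; lra.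
- by move=> i; rewrite ffunE; case: (x i) => /=; lra.
- by move=> i; rewrite ffunE; case: (y i) => /=; lra.
- by move=> i; rewrite ffunE; case: (z i) => /=; lra.
Qed.

Definition drift_x {R : realType} {n m l : nat} (c : weights R)
    (x : {ffun 'I_n -> bool}) (y : {ffun 'I_m -> bool}) (z : {ffun 'I_l -> bool})
    (G : tensor bool n m l) (i : 'I_n) : R :=
  \sum_(e | e.1.1 == i) slope_x c (x e.1.1) (y e.1.2) (z e.2) (G e != outer x y z e).

Definition drift_y {R : realType} {n m l : nat} (c : weights R)
    (x : {ffun 'I_n -> bool}) (y : {ffun 'I_m -> bool}) (z : {ffun 'I_l -> bool})
    (G : tensor bool n m l) (j : 'I_m) : R :=
  \sum_(e | e.1.2 == j) slope_y c (x e.1.1) (y e.1.2) (z e.2) (G e != outer x y z e).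

Definition drift_z {R : realType} {n m l : nat} (c : weights R)
    (x : {ffun 'I_n -> bool}) (y : {ffun 'I_m -> bool}) (z : {ffun 'I_l -> bool})
    (G : tensor bool n m l) (k : 'I_l) : R :=
  \sum_(e | e.2 == k) slope_z c (x e.1.1) (y e.1.2) (z e.2) (G e != outer x y z e).

Lemma gap_ge0 (R : realType) (u : bool) (t : R) : 0 <= t <= 1 -> 0 <= gap u t.
Proof. by rewrite /gap; case: u; lra. Qed.

Lemma gap_eq0 (R : realType) (u : bool) (t : R) : gap u t = 0 -> t = u%:R.
Proof. by rewrite /gap; case: u => /=; lra. Qed.

Lemma weighted_sum_eq0 (R : realType) (I : finType) (a g : I -> R) :
  (forall i, 0 < a i) -> (forall i, 0 <= g i) -> \sum_i a i * g i <= 0 ->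
  forall i, g i = 0.
Proof.
move=> a0 g0 le0 i.
have ag0 j : true -> 0 <= a j * g j by move=> _; rewrite mulr_ge0 // ltW.
have sum0 : \sum_i a i * g i = 0 by apply/eqP; rewrite eq_le le0 sumr_ge0.
have /eqP := psumr_eq0P ag0 sum0 (i := i) isT.
  by rewrite mulf_eq0 gt_eqF //= => /eqP.
Qed.

(** The gaps of an optimal point vanish because their combination with positive
    coefficients is at most its excess cost over the ground truth, which is at
    most 0.  Then every entry has nonnegative excess, the excesses sum to 0, and
    the excess of an entry is, up to sign, the difference between w and the ground truth. *)
Lemma recovers_of_drift_gt0 (R : realType) (n m l : nat) (c : weights R)
    (x : {ffun 'I_n -> bool}) (y : {ffun 'I_m -> bool}) (z : {ffun 'I_l -> bool})
    (G H : tensor bool n m l) :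
  admissible c -> monotone_transform (outer x y z) G H ->
  (forall i, 0 < drift_x c x y z G i) ->
  (forall j, 0 < drift_y c x y z G j) ->
  (forall k, 0 < drift_z c x y z G k) ->
  sLP_recovers R x y z H.
Proof.
move=> adm [S _ HG] dx dy dz.
set W := outer x y z in HG *.
have WE i j k : W (i, j, k) = [&& x i, y j & z k] by rewrite ffunE.
have HGW e : H e = G e \/ H e = W e by rewrite HG ffunE; case: ifP; [right|left].
pose cost (s : lp_point R n m l) e : R := if H e then 1 - lp_w s e else lp_w s e.
pose excess s e : R := cost s e - (H e != W e)%:R.
pose gx (s : lp_point R n m l) i : R := gap (x i) (lp_x s i).
pose gy (s : lp_point R n m l) j : R := gap (y j) (lp_y s j).
pose gz (s : lp_point R n m l) k : R := gap (z k) (lp_z s k).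
pose lin (s : lp_point R n m l) (e : 'I_n * 'I_m * 'I_l) :=
  slope_x c (x e.1.1) (y e.1.2) (z e.2) (G e != W e) * gx s e.1.1
  + slope_y c (x e.1.1) (y e.1.2) (z e.2) (G e != W e) * gy s e.1.2
  + slope_z c (x e.1.1) (y e.1.2) (z e.2) (G e != W e) * gz s e.2.
have lin_excess s e : sLP_feasible H s -> lin s e <= excess s e.
  case: e => [[i j] k] [f1 f0 fx fy fz].
  have := @entry_gain R c (lp_x s i) (lp_y s j) (lp_z s k) (lp_w s (i, j, k))
    (x i) (y j) (z k) (G (i, j, k)) (H (i, j, k)) adm (fx i) (fy j) (fz k).
  rewrite /lin /excess /cost WE /=; apply.
  - by rewrite -WE.
  - by move=> h1; apply: f1; rewrite inE.
  - by move=> h0; apply: f0; rewrite inE.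
have linE s : \sum_e lin s e = \sum_i drift_x c x y z G i * gx s i
    + \sum_j drift_y c x y z G j * gy s j + \sum_k drift_z c x y z G k * gz s k.
  rewrite !big_split /=; congr (_ + _ + _).
  - rewrite (partition_big (fun e => e.1.1) xpredT) //=; apply: eq_bigr => i _.
    by rewrite mulr_suml; apply: eq_bigr => e /eqP ->.
  - rewrite (partition_big (fun e => e.1.2) xpredT) //=; apply: eq_bigr => j _.
    by rewrite mulr_suml; apply: eq_bigr => e /eqP ->.
  - rewrite (partition_big (fun e => e.2) xpredT) //=; apply: eq_bigr => k _.
    by rewrite mulr_suml; apply: eq_bigr => e /eqP ->.
have objB s : sLP_objective H s - sLP_objective H (truth R x y z) = \sum_e excess s e.
  rewrite !sLP_objectiveE -sumrB; apply: eq_bigr => e _; rewrite /excess /cost /= ffunE -/W.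
  by case: (H e); case: (W e) => /=; lra.
have px s : sLP_feasible H s -> forall i, 0 <= drift_x c x y z G i * gx s i.
  by case=> _ _ fx _ _ i; rewrite mulr_ge0 ?gap_ge0 // ltW.
have py s : sLP_feasible H s -> forall j, 0 <= drift_y c x y z G j * gy s j.
  by case=> _ _ _ fy _ j; rewrite mulr_ge0 ?gap_ge0 // ltW.
have pz s : sLP_feasible H s -> forall k, 0 <= drift_z c x y z G k * gz s k.
  by case=> _ _ _ _ fz k; rewrite mulr_ge0 ?gap_ge0 // ltW.
have lin_le s : sLP_feasible H s -> \sum_e lin s e <= \sum_e excess s e.
  by move=> fs; apply: ler_sum => e _; exact: lin_excess.
have tf := truth_feasible R x y z H.
move=> s; split; last first.
  move=> ->; split=> // t ft; rewrite -subr_ge0 objB; apply: le_trans (lin_le _ ft).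
  by rewrite linE !addr_ge0 //; apply: sumr_ge0 => ? _; [exact: px|exact: py|exact: pz].
case=> fs /(_ _ tf); rewrite -subr_le0 objB => ex0.
have sx0 : 0 <= \sum_i drift_x c x y z G i * gx s i by apply: sumr_ge0 => i _; exact: px.
have sy0 : 0 <= \sum_j drift_y c x y z G j * gy s j by apply: sumr_ge0 => j _; exact: py.
have sz0 : 0 <= \sum_k drift_z c x y z G k * gz s k by apply: sumr_ge0 => k _; exact: pz.
have lle := lin_le s fs; rewrite linE in lle.
have zx i : gx s i = 0.
  by apply: (weighted_sum_eq0 dx) => [i'|]; [case: fs => *; exact: gap_ge0|lra].
have zy j : gy s j = 0.
  by apply: (weighted_sum_eq0 dy) => [j'|]; [case: fs => *; exact: gap_ge0|lra].
have zz k : gz s k = 0.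
  by apply: (weighted_sum_eq0 dz) => [k'|]; [case: fs => *; exact: gap_ge0|lra].
have ex_ge0 e : 0 <= excess s e.
  by apply: le_trans (lin_excess s e fs); rewrite /lin zx zy zz !mulr0 !addr0.
have ez : \sum_e excess s e = 0 by apply/eqP; rewrite eq_le ex0 sumr_ge0.
have wE e : lp_w s e = (W e)%:R.
  have := psumr_eq0P (fun e _ => ex_ge0 e) ez (i := e) isT; rewrite /excess /cost.
  by case: (H e); case: (W e) => /=; lra.
case: s zx zy zz wE {fs ex0 sx0 sy0 sz0 lle ex_ge0 ez} => sx sy sz sw zx zy zz wE.
congr LPPoint; apply/ffunP => e; rewrite [RHS]ffunE.
- exact: gap_eq0 (zx e).
- exact: gap_eq0 (zy e).
- exact: gap_eq0 (zz e).
- exact: wE.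
Qed.

(** * Recovery with high probability *)

(** The union bound over the n + m + l slices, indexed by a sum type. *)
Lemma recovery_probability (R : realType) (n m l : nat) (p eps : R) (c : weights R)
    (x : {ffun 'I_n -> bool}) (y : {ffun 'I_m -> bool}) (z : {ffun 'I_l -> bool})
    (adv : tensor bool n m l -> tensor bool n m l) :
  0 <= p <= 1 -> 0 < eps <= 1 -> admissible c ->
  positive_drift p (ratio_ones R x) (ratio_ones R y) (ratio_ones R z) eps c ->
  monotone_adversary (outer x y z) adv ->
  1 - (n%:R * expR (- (eps ^+ 2 / 8 * (m%:R * l%:R)))
       + m%:R * expR (- (eps ^+ 2 / 8 * (n%:R * l%:R)))
       + l%:R * expR (- (eps ^+ 2 / 8 * (n%:R * m%:R))))
  <= fully_random_pr p (outer x y z) (fun G => sLP_recovers R x y z (adv G)) <= 1.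
Proof.
move=> p01 eps01 adm [dx dy dz] mono.
pose bad (q : 'I_n + 'I_m + 'I_l) (G : tensor bool n m l) : Prop :=
  match q with
  | inl (inl i) => drift_x c x y z G i <= 0
  | inl (inr j) => drift_y c x y z G j <= 0
  | inr k => drift_z c x y z G k <= 0
  end.
have good G : (forall q, ~ bad q G) -> sLP_recovers R x y z (adv G).
  move=> ok; apply: (recovers_of_drift_gt0 adm (mono G)) => i.
  - by have /negP := ok (inl (inl i)); rewrite -ltNge.
  - by have /negP := ok (inl (inr i)); rewrite -ltNge.
  - by have /negP := ok (inr i); rewrite -ltNge.
have /andP[lo ->] := union_bound (outer x y z) p01 good.
rewrite andbT; apply: le_trans lo; rewrite lerD2l lerN2 !big_sumType /=.
have cst a b (N : nat) (F : 'I_N -> R) : (forall i, F i <= expR (- (eps ^+ 2 / 8 * (a * b)))) ->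
    \sum_i F i <= N%:R * expR (- (eps ^+ 2 / 8 * (a * b))).
  move=> le; rewrite mulr_natl -[X in _ *+ X]card_ord -sumr_const.
  by apply: ler_sum => i _; exact: le.
apply: lerD; first apply: lerD; apply: cst => i.
- have := @corruption_chernoff R n m l p eps (outer x y z) (fun e => e.1.1 == i)
    (fun e => slope_x c (x e.1.1) (y e.1.2) (z e.2)) (m%:R * l%:R) p01 eps01.
  rewrite !sum_slice_x /= !sumr_const !card_ord
    (sum_bvec2 y z (fun v w => bmean p (slope_x c (x i) v w))); apply.
  + by move=> e d; case: (slope_norm_le1 (x e.1.1) (y e.1.2) (z e.2) d adm).
  + by rewrite -natrM mulrnAC -mulrnA.
  + by rewrite mulrC ler_wpM2l ?mulr_ge0.
- have := @corruption_chernoff R n m l p eps (outer x y z) (fun e => e.1.2 == i)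
    (fun e => slope_y c (x e.1.1) (y e.1.2) (z e.2)) (n%:R * l%:R) p01 eps01.
  rewrite !sum_slice_y /= !sumr_const !card_ord
    (sum_bvec2 x z (fun u w => bmean p (slope_y c u (y i) w))); apply.
  + by move=> e d; case: (slope_norm_le1 (x e.1.1) (y e.1.2) (z e.2) d adm).
  + by rewrite -natrM mulrnAC -mulrnA.
  + by rewrite mulrC ler_wpM2l ?mulr_ge0.
- have := @corruption_chernoff R n m l p eps (outer x y z) (fun e => e.2 == i)
    (fun e => slope_z c (x e.1.1) (y e.1.2) (z e.2)) (n%:R * m%:R) p01 eps01.
  rewrite !sum_slice_z /= !sumr_const !card_ord
    (sum_bvec2 x y (fun u v => bmean p (slope_z c u v (z i)))); apply.
  + by move=> e d; case: (slope_norm_le1 (x e.1.1) (y e.1.2) (z e.2) d adm).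
  + by rewrite -natrM mulrnAC -mulrnA.
  + by rewrite mulrC ler_wpM2l ?mulr_ge0.
Qed.

(** * The asymptotic statement *)

Lemma delta_ge0 (R : realType) (rx ry rz : R) :
  0 < rz -> rz <= ry -> ry <= rx -> 0 <= delta rx ry rz.
Proof.
move=> rz0 zy yx.
have h1 : 0 <= ry * (rx - rz) by rewrite mulr_ge0; lra.
have h2 : 0 <= rz * (rx - ry) by rewrite mulr_ge0; lra.
by rewrite /delta; lra.
Qed.

Lemma ratio_ones_le1 (R : realType) (n : nat) (x : {ffun 'I_n -> bool}) :
  ratio_ones R x <= 1.
Proof.
rewrite /ratio_ones; case: n x => [|n] x; first by rewrite invr0 mulr0.
by rewrite ler_pdivrMr ?ltr0n // mul1r ler_nat -[leqRHS]card_ord max_card.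
Qed.

(** A slice has b c entries, and k c >= 1 once c is large. *)
Lemma slice_tail_le (R : realType) (a b c : nat -> nat) (k : R) : 0 < k ->
  c N @[N --> \oo] --> \oo ->
  \forall N \near \oo, (a N)%:R * expR (- (k * ((b N)%:R * (c N)%:R)))
    <= (a N)%:R * expR (- (b N)%:R) :> R.
Proof.
move=> k0 /cvgrnyP - /(_ R) /cvgryPge /(_ k^-1); apply: filterS => N kc.
rewrite ler_wpM2l // ler_expR lerN2 mulrCA ler_peMr //.
by rewrite -ler_pdivrMl // mulr1.
Qed.

Theorem theorem3 (R : realType) (rx ry rz : R)
    (hrz : 0 < rz) (hyz : rz <= ry) (hxy : ry <= rx) :
  0 <= delta rx ry rz /\
  forall (n m l : nat -> nat)
    (x : forall N, {ffun 'I_(n N) -> bool})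
    (y : forall N, {ffun 'I_(m N) -> bool})
    (z : forall N, {ffun 'I_(l N) -> bool})
    (p : R)
    (adv : forall N, tensor bool (n N) (m N) (l N) ->
                     tensor bool (n N) (m N) (l N)),
    n N @[N --> \oo] --> \oo ->
    m N @[N --> \oo] --> \oo ->
    l N @[N --> \oo] --> \oo ->
    (forall N, ratio_ones R (x N) = rx) ->
    (forall N, ratio_ones R (y N) = ry) ->
    (forall N, ratio_ones R (z N) = rz) ->
    (n N)%:R * expR (- (m N)%:R) @[N --> \oo] --> (0 : R) ->
    (n N)%:R * expR (- (l N)%:R) @[N --> \oo] --> (0 : R) ->
    (m N)%:R * expR (- (n N)%:R) @[N --> \oo] --> (0 : R) ->
    (m N)%:R * expR (- (l N)%:R) @[N --> \oo] --> (0 : R) ->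
    (l N)%:R * expR (- (n N)%:R) @[N --> \oo] --> (0 : R) ->
    (l N)%:R * expR (- (m N)%:R) @[N --> \oo] --> (0 : R) ->
    0 <= p <= 1 ->
    p < rx * ry * rz / (2 * (1 + rx * ry * rz) + delta rx ry rz) ->
    (forall N, monotone_adversary (outer (x N) (y N) (z N)) (adv N)) ->
    fully_random_pr p (outer (x N) (y N) (z N))
      (fun G => sLP_recovers R (x N) (y N) (z N) (adv N G))
      @[N --> \oo] --> (1 : R).
Proof.
have d0 := delta_ge0 hrz hyz hxy; split=> //.
move=> n m l x y z p adv noo moo loo rxE ryE rzE nm _ mn _ ln _ p01 hp mono.
have ry0 : 0 < ry by lra.
have rx0 : 0 < rx by lra.
have rx01 : 0 < rx <= 1 by rewrite rx0 -(rxE 0%N) ratio_ones_le1.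
have ry01 : 0 < ry <= 1 by rewrite ry0 -(ryE 0%N) ratio_ones_le1.
have rz01 : 0 < rz <= 1 by rewrite hrz -(rzE 0%N) ratio_ones_le1.
have r0 : 0 < rx * ry * rz by rewrite !mulr_gt0.
have hp' : p < rx * ry * rz / (2 * (1 + rx * ry * rz)).
  by apply: lt_le_trans hp _; rewrite ler_pM2l // lef_pV2 ?posrE ?lerDl ?ltr_wpDr // mulr_gt0 // addr_gt0.
have p0 : 0 <= p by case/andP: p01.
have [c [eps eps01 [adm drift]]] := weights_exist rx01 ry01 rz01 p0 hp'.
have k0 : 0 < eps ^+ 2 / 8 by case/andP: eps01 => e0 _; rewrite divr_gt0 ?exprn_gt0.
pose err N : R := (n N)%:R * expR (- (m N)%:R) + (m N)%:R * expR (- (n N)%:R)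
  + (l N)%:R * expR (- (n N)%:R).
apply: (@squeeze_cvgr _ _ _ _ (fun N => 1 - err N) (fun=> 1)); last exact: cvg_cst.
- have tn := slice_tail_le n m k0 loo.
  have tm := slice_tail_le m n k0 loo.
  have tl := slice_tail_le l n k0 moo.
  near=> N.
  have drN : positive_drift p (ratio_ones R (x N)) (ratio_ones R (y N))
      (ratio_ones R (z N)) eps c by rewrite rxE ryE rzE.
  have /andP[lo ->] := recovery_probability p01 eps01 adm drN (mono N).
  rewrite andbT; apply: le_trans lo; rewrite lerD2l lerN2 /err !lerD //.
  + by near: N.
  + by near: N.
  + by near: N.
- rewrite -[X in _ --> X](subr0 1); apply: cvgB; first exact: cvg_cst.
  rewrite -[X in _ --> X](addr0 0) -[X in _ --> X + _](addr0 0).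
  by apply: cvgD => //; apply: cvgD.
Unshelve. all: by end_near.
Qed.
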